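(* Let $K$ be an algebraically closed field and let $S$ be an $\mathbb{N}$-graded $K$-algebra that is a domain. Let $F_1,\dots,F_n$ be homogeneous elements of positive degree in $S$ that form a regular sequence in $S$ and generate a prime ideal $Q$ of $S$. Then the $K$-algebra homomorphism from the polynomial ring $K[X_1,\dots,X_n] \to S$ given by $X_i \mapsto F_i$ ($1 \le i \le n$) has the stable prime extension property.
   Context: All rings are commutative with identity. A ring homomorphism $R \to S$ has the prime extension property if for every prime ideal $P$ of $R$, $PS$ is prime in $S$ or $PS = S$; it has the stable prime extension property if for every $m \ge 0$, $R[Y_1,\dots,Y_m] \to S[Y_1,\dots,Y_m]$ has the prime extension property. *)

(* Defs.v *)
From HB Require Import structures.
From mathcomp Require Import all_boot all_order all_algebra all_field.
Set Implicit Arguments. Unset Strict Implicit. Unset Printing Implicit Defensive.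
Import Order.TTheory GRing.Theory Num.Theory.
Local Open Scope ring_scope.

Definition is_ideal (A : comNzRingType) (I : A -> Prop) : Prop :=
  [/\ I 0, (forall x y, I x -> I y -> I (x + y)) & (forall a x, I x -> I (a * x))].

Definition prime_ideal (A : comNzRingType) (I : A -> Prop) : Prop :=
  [/\ is_ideal I, ~ I 1 & (forall a b, I (a * b) -> I a \/ I b)].

Definition ext_ideal (A B : comNzRingType) (f : A -> B) (P : A -> Prop) (y : B) : Prop :=
  exists (k : nat) (b : nat -> B) (a : nat -> A),
    (forall i, (i < k)%N -> P (a i)) /\ y = \sum_(i < k) b i * f (a i).

Definition prime_ext_prop (A B : comNzRingType) (f : A -> B) : Prop :=
  forall P : A -> Prop, prime_ideal P -> prime_ideal (ext_ideal f P) \/ ext_ideal f P 1.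

Fixpoint polyn (R : comNzRingType) (m : nat) : comNzRingType :=
  match m with
  | 0 => R
  | m'.+1 => ({poly polyn R m'} : comNzRingType)
  end.

Fixpoint liftn (R S : comNzRingType) (f : R -> S) (m : nat) : polyn R m -> polyn S m :=
  match m return polyn R m -> polyn S m with
  | 0 => f
  | m'.+1 => fun p => map_poly (@liftn R S f m') p
  end.
Arguments liftn [R S] f m _.

Definition stable_prime_ext_prop (A B : comNzRingType) (f : A -> B) : Prop :=
  forall m : nat, prime_ext_prop (liftn f m).

(* The K-algebra map K[X_1,...,X_n] -> S, X_(i+1) |-> F i (i < n), where the
   K-algebra structure of S is given by iota : K -> S. *)
Fixpoint evalF (K : comNzRingType) (S : comNzRingType) (iota : K -> S)
    (F : nat -> S) (n : nat) : polyn K n -> S :=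
  match n return polyn K n -> S with
  | 0 => iota
  | n'.+1 => fun p => (map_poly (@evalF K S iota F n') p).[F n']
  end.
Arguments evalF [K S] iota F n _.

Definition is_Ngrading (K : fieldType) (S : comNzRingType) (iota : K -> S)
    (Sd : nat -> S -> Prop) : Prop :=
  [/\ (forall d, Sd d 0),
      (forall d x y, Sd d x -> Sd d y -> Sd d (x + y)),
      (forall d (c : K) x, Sd d x -> Sd d (iota c * x)),
      (forall d e x y, Sd d x -> Sd e y -> Sd (d + e)%N (x * y)) &
      (forall s : S, exists (N : nat) (c : nat -> S),
          (forall i, Sd i (c i)) /\ s = \sum_(i < N) c i) /\
      (forall (N : nat) (c : nat -> S), (forall i, Sd i (c i)) ->
          \sum_(i < N) c i = 0 -> forall i, (i < N)%N -> c i = 0)].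

Definition ideal_gen (S : comNzRingType) (F : nat -> S) (k : nat) (x : S) : Prop :=
  exists a : nat -> S, x = \sum_(i < k) a i * F i.

Definition regular_seq (S : comNzRingType) (F : nat -> S) (n : nat) : Prop :=
  (forall i, (i < n)%N -> forall s, ideal_gen F i (F i * s) -> ideal_gen F i s)
  /\ ~ ideal_gen F n 1.

(* Main.v *)
(* Let R = K[X_1,...,X_n], and let P be a prime of R[Y]. Homogeneous elements of S that
   form a K-basis modulo Q span S over R (graded Nakayama), hence S[Y] over R[Y]. At a
   K-point of R[Y] where X_i takes the value a_i, the fibre of S is S/(F_i - a_i); as F
   is regular, the leading forms of elements of (F_i - a_i) lie in Q, so this fibre is a
   domain and the chosen elements stay independent in it. If u and v lie outside PS[Y],
   some coefficient of u and some coefficient of v lie outside P, and the Nullstellensatz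
   gives a K-point killing P at which neither coefficient vanishes. The images of u and v
   in the fibre are then nonzero, so uv is not in PS[Y]. *)
From HB Require Import structures.
From mathcomp Require Import all_boot all_order all_algebra all_field.
From mathcomp Require Import ring zify.
From Stdlib Require Import Classical ClassicalEpsilon.
(* Imported last: mathcomp's qpoly also exports a [polyn]. *)
Require Import Defs.
Set Implicit Arguments. Unset Strict Implicit. Unset Printing Implicit Defensive.
Import GRing.Theory.
Local Open Scope ring_scope.

(** * Ideals given by predicates *)

Lemma idealN (A : comNzRingType) (I : A -> Prop) x : is_ideal I -> I x -> I (- x).
Proof. by case=> _ _ IM /(IM (-1)); rewrite mulN1r. Qed.

Lemma idealB (A : comNzRingType) (I : A -> Prop) x y :
  is_ideal I -> I x -> I y -> I (x - y).
Proof. by move=> II Ix Iy; case: (II) => _ ID _; apply: ID => //; apply: idealN. Qed.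

Lemma idealMr (A : comNzRingType) (I : A -> Prop) a x : is_ideal I -> I x -> I (x * a).
Proof. by case=> _ _ IM /(IM a); rewrite mulrC. Qed.

Lemma ideal_sum (A : comNzRingType) (I : A -> Prop) k (x : nat -> A) :
  is_ideal I -> (forall i, (i < k)%N -> I (x i)) -> I (\sum_(i < k) x i).
Proof. by case=> I0 ID _ Ix; elim/big_ind: _ => // i _; apply: Ix. Qed.

Lemma ideal_gen_ideal (A : comNzRingType) (F : nat -> A) k : is_ideal (ideal_gen F k).
Proof.
split.
- by exists (fun=> 0); rewrite big1 // => i _; rewrite mul0r.
- move=> x y [a ->] [b ->]; exists (fun i => a i + b i).
  by rewrite -big_split; apply: eq_bigr => i _; rewrite mulrDl.
- move=> c x [a ->]; exists (fun i => c * a i).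
  by rewrite mulr_sumr; apply: eq_bigr => i _; rewrite mulrA.
Qed.

Lemma ideal_gen_mem (A : comNzRingType) (F : nat -> A) k i :
  (i < k)%N -> ideal_gen F k (F i).
Proof.
move=> lt_ik; exists (fun j => (j == i)%:R).
rewrite (bigD1 (Ordinal lt_ik)) //= eqxx mul1r big1 ?addr0 // => j ne_ji.
by rewrite -[i]/(val (Ordinal lt_ik)) val_eqE (negPf ne_ji) mul0r.
Qed.

Lemma ideal_gen_le (A : comNzRingType) (F : nat -> A) k x :
  ideal_gen F k x -> ideal_gen F k.+1 x.
Proof.
case=> a ->; exists (fun i => if (i < k)%N then a i else 0).
rewrite big_ord_recr /= ltnn mul0r addr0.
by apply: eq_bigr => i _; rewrite ltn_ord.
Qed.

Lemma ideal_genS (A : comNzRingType) (F : nat -> A) k x :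
  ideal_gen F k.+1 x -> exists j g, ideal_gen F k j /\ x = j + g * F k.
Proof.
by case=> a ->; exists (\sum_(i < k) a i * F i), (a k); rewrite big_ord_recr; split=> //; exists a.
Qed.

Lemma prime_ideal_exp (A : comNzRingType) (P : A -> Prop) x k :
  prime_ideal P -> P (x ^+ k) -> P x.
Proof.
case=> _ nP1 PM; elim: k => [|k IH]; first by rewrite expr0.
by rewrite exprS => /PM[].
Qed.

(** * The Nullstellensatz for iterated polynomial rings *)

Lemma ideal_coefs (A : comNzRingType) (P : {poly A} -> Prop) (f : {poly A}) :
  is_ideal P -> (forall i, P (f`_i)%:P) -> P f.
Proof.
move=> IP Pf; rewrite -[f]coefK poly_def.
apply: (@ideal_sum _ _ _ (fun i => f`_i *: 'X^i)) => // i _.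
by rewrite -mul_polyC; apply: idealMr.
Qed.

(** Leading terms with coefficient in [P] are deleted one by one; this stops because the size drops
    each time. *)
Lemma trim_mod_ideal (A : comNzRingType) (P : {poly A} -> Prop) (f : {poly A}) :
  is_ideal P ->
  exists f1 : {poly A}, [/\ (forall i, P ((f - f1)`_i)%:P), (size f1 <= size f)%N &
                 f1 = 0 \/ ~ P (lead_coef f1)%:P].
Proof.
move=> IP; have [P0 PD _] := IP.
elim: {f}(size f) {-2}f (leqnn (size f)) => [|s IH] f le_fs.
  exists f; split=> // [i|]; first by rewrite subrr coef0.
  by left; apply/eqP; rewrite -size_poly_leq0.
have [Pl|nPl] := classic (P (lead_coef f)%:P); last first.
  by exists f; split=> // [i|]; [rewrite subrr coef0 | right].
have [->|f0] := eqVneq f 0.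
  by exists 0; split=> // [i|]; [rewrite subrr coef0 | left].
set m := lead_coef f *: 'X^((size f).-1).
have szf : (0 < size f)%N by rewrite size_poly_gt0.
have lt_sz : (size (f - m)%R < size f)%N.
  rewrite -(prednK szf) ltnS; apply/leq_sizeP => j le_j.
  rewrite coefB coefZ coefXn; have [->|ne_j] := eqVneq j (size f).-1.
    by rewrite mulr1 subrr.
  by rewrite mulr0 subr0 nth_default // -(prednK szf) ltn_neqAle eq_sym ne_j.
have [|f1 [Pf1 sz1 or1]] := IH (f - m); first by lia.
exists f1; split=> // [i|]; last by lia.
have -> : f - f1 = (f - m - f1) + m by ring.
rewrite coefD polyCD; apply: PD => //; rewrite coefZ polyCM.
exact: idealMr.
Qed.

(** The Nullstellensatz for [A] as a [K]-algebra via [c]: every prime is an intersection of kernels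
    of [K]-points. *)
Definition separates_points (K : fieldType) (A : comNzRingType) (c : K -> A) :=
  forall (P : A -> Prop) (g : A), prime_ideal P -> ~ P g ->
  exists phi : {rmorphism A -> K},
    [/\ forall x, phi (c x) = x, forall p, P p -> phi p = 0 & phi g != 0].

Lemma separates_points_field (K : fieldType) : separates_points (idfun : K -> K).
Proof.
move=> P g [[P0 _ PM] nP1 _] nPg; exists idfun; split=> // [p Pp|] /=.
  by apply/eqP/negP => /negP p0; apply: nP1; rewrite -(mulVf p0); apply: PM.
by apply/eqP => g0; apply: nPg; rewrite g0.
Qed.

Lemma ex_min_size (A : comNzRingType) (Q : {poly A} -> Prop) f :
  Q f -> exists2 h, Q h & forall h', Q h' -> (size h <= size h')%N.
Proof.
elim: {f}(size f) {-2}f (leqnn (size f)) => [|s IH] f le_fs Qf.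
  by exists f => // h' _; lia.
have [[h [Qh lt_h]]|nex] := classic (exists h, Q h /\ (size h < size f)%N).
  by apply: (IH h) => //; lia.
exists f => // h' Qh'; rewrite leqNgt; apply/negP => lt; apply: nex; by exists h'.
Qed.

(* Bezout over the fraction field of A/p, where p is the contraction of P: a minimal
   f generates P there, hence is irreducible and coprime to every g outside P. *)
Lemma prime_poly_bezout (A : comNzRingType) (P : {poly A} -> Prop) (g : {poly A}) :
  prime_ideal P -> ~ P g -> (exists2 f, P f & ~ forall i, P (f`_i)%:P) ->
  exists (f : {poly A}) (d : A),
    [/\ P f, ~ P d%:P, (1 < size f)%N /\ ~ P (lead_coef f)%:P,
        exists a b w : {poly A}, [/\ d%:P = a * g + b * f + w & forall i, P (w`_i)%:P] &
        forall h, P h -> exists (k : nat) (q r : {poly A}),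
          lead_coef f ^+ k *: h = q * f + r /\ forall i, P (r`_i)%:P].
Proof.
move=> PP nPg [f0 Pf0 nf0]; have [IP nP1 PM] := PP; have [P0 PD PZ] := IP.
have Pcst (h : {poly A}) : (size h <= 1)%N -> P h -> forall i, P (h`_i)%:P.
  by move=> /size1_polyC -> Ph i; rewrite coefC; case: eqP.
have Pcfs (h w : {poly A}) : (forall i, P (w`_i)%:P) -> forall i, P ((h * w)`_i)%:P.
  move=> Pw i; rewrite coefM rmorph_sum; elim/big_ind: _ => // j _.
  by rewrite /= polyCM; apply: PZ; apply: Pw.
(* Over the fraction field of [A/p], [f1] is a nonzero element of [P] of least degree; trimming it
   to [f] puts the leading coefficient outside [P]. *)
have [f1 [Pf1 nf1] fmin] :=
  @ex_min_size A (fun f => P f /\ ~ forall i, P (f`_i)%:P) f0 (conj Pf0 nf0).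
have [f [Pff sz_f or_f]] := trim_mod_ideal f1 IP.
have Pf : P f.
  by rewrite -[f](subKr f1); apply: idealB => //; apply: ideal_coefs.
have nPl : ~ P (lead_coef f)%:P.
  by case: or_f => // f_0; case: nf1 => i; have := Pff i; rewrite f_0 subr0.
have nPf : ~ forall i, P (f`_i)%:P by move=> /(_ (size f).-1).
have {}fmin h : P h -> (size h < size f)%N -> forall i, P (h`_i)%:P.
  move=> Ph lt_h; apply: NNPP => nPh; have := fmin h (conj Ph nPh); lia.
have sz1_f : (1 < size f)%N.
  by rewrite ltnNge; apply/negP => /Pcst /(_ Pf).
have f_n0 : f != 0 by rewrite -size_poly_gt0; lia.
have fdiv h : P h -> exists (k : nat) (q r : {poly A}),
          lead_coef f ^+ k *: h = q * f + r /\ forall i, P (r`_i)%:P.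
  move=> Ph; have := Pdiv.ComRing.rdivp_eq f h.
  set k := Pdiv.Ring.rscalp _ _; set q := Pdiv.Ring.rdivp _ _.
  set r := Pdiv.Ring.rmodp _ _ => E; exists k, q, r; split=> //.
  apply: fmin; last exact: Pdiv.CommonRing.ltn_rmodpN0.
  have -> : r = lead_coef f ^+ k *: h - q * f by rewrite E; ring.
  by apply: idealB => //; [rewrite -mul_polyC|]; apply: PZ.
(* [J] is the ideal generated by [g], [f] and the contraction of [P]. A shortest member outside [P],
   once trimmed, is shown to be constant and serves as [d]. *)
pose J (h : {poly A}) := exists a b w : {poly A},
  [/\ h = a * g + b * f + w & forall i, P (w`_i)%:P].
have Jg : J g by exists 1, 0, 0; split=> [|i]; [ring | rewrite coef0].
have JD (x y : {poly A}) : J x -> J y -> J (x + y).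
  move=> [a [b [w [-> Pw]]]] [a' [b' [w' [-> Pw']]]].
  exists (a + a'), (b + b'), (w + w'); split=> [|i]; first by ring.
  by rewrite coefD polyCD; apply: PD.
have JM (x y : {poly A}) : J y -> J (x * y).
  move=> [a [b [w [-> Pw]]]]; exists (x * a), (x * b), (x * w).
  by split; [ring | apply: Pcfs].
have JN (x : {poly A}) : J x -> J (- x) by rewrite -mulN1r; apply: JM.
have Jf : J f by exists 0, 1, 0; split=> [|i]; [ring | rewrite coef0].
have Jw (w : {poly A}) : (forall i, P (w`_i)%:P) -> J w by exists 0, 0, w; split=> //; ring.
have [h1 [Jh1 nPh1] h1min] := @ex_min_size A (fun h => J h /\ ~ P h) g (conj Jg nPg).
have [h [Phh sz_h or_h]] := trim_mod_ideal h1 IP.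
have hE : h = h1 - (h1 - h) by ring.
have Jh : J h by rewrite hE; apply/JD/JN/Jw.
have nPh : ~ P h.
  move=> Ph; apply: nPh1; rewrite -[h1](subrK h); apply: PD => //.
  exact: ideal_coefs.
have nPlh : ~ P (lead_coef h)%:P by case: or_h => // h_0; case: nPh; rewrite h_0.
have hmin h' : J h' -> (size h' < size h)%N -> P h'.
  move=> Jh' lt_h; apply: NNPP => nPh'; have := h1min h' (conj Jh' nPh'); lia.
have h_n0 : h != 0 by apply/eqP => h_0; apply: nPh; rewrite h_0.
suff sz1_h : (size h <= 1)%N.
  have /size1_polyC h_C := sz1_h.
  by exists f, h`_0; rewrite -h_C; split.
(* Otherwise the pseudo-remainder of [h] by [f], in [J] and shorter than [h], lies in [P]; then so
   does a power of [lead_coef f] times [h]. *)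
have lt_hf : (size h < size f)%N.
  have := Pdiv.ComRing.rdivp_eq f h.
  set k := Pdiv.Ring.rscalp _ _; set q := Pdiv.Ring.rdivp _ _.
  set r := Pdiv.Ring.rmodp _ _ => E.
  have lt_r : (size r < size f)%N by exact: Pdiv.CommonRing.ltn_rmodpN0.
  rewrite ltnNge; apply/negP => le_fh.
  have rE : r = (lead_coef f ^+ k)%:P * h - q * f by rewrite mul_polyC E; ring.
  have Pr : P r.
    by apply: hmin; [rewrite rE; apply/JD/JN/JM/Jf/JM | exact: leq_trans le_fh].
  have : P ((lead_coef f ^+ k)%:P * h).
    by rewrite mul_polyC E; apply: PD => //; apply: PZ.
  by case/PM => //; rewrite polyC_exp => /(prime_ideal_exp PP).
(* For nonconstant [h], pseudo-divide [f] by [h]. The remainder vanishes modulo the contraction, so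
   [q * h], hence [q], lies in [P]. Modulo the contraction [q] is shorter than [f], so it vanishes
   too, which puts a power of [lead_coef h] times [lead_coef f] into [P]. *)
rewrite leqNgt; apply/negP => sz1_h.
have := Pdiv.ComRing.rdivp_eq h f.
set k := Pdiv.Ring.rscalp _ _; set q := Pdiv.Ring.rdivp _ _.
set r := Pdiv.Ring.rmodp _ _ => E.
have lt_r : (size r < size h)%N by exact: Pdiv.CommonRing.ltn_rmodpN0.
have rE : r = (lead_coef h ^+ k)%:P * f - q * h by rewrite mul_polyC E; ring.
have Pr : P r.
  by apply: hmin => //; rewrite rE; apply/JD/JN/JM/Jh/JM.
have Prc : forall i, P (r`_i)%:P by apply: fmin => //; apply: ltn_trans lt_hf.
have Pq : P q.
  have : P (q * h).
    by rewrite -[q * h](addrK r) -E; apply: idealB => //; rewrite -mul_polyC; apply: PZ.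
  by case/PM.
have nPhk : ~ P (lead_coef h ^+ k)%:P by rewrite polyC_exp => /(prime_ideal_exp PP).
have [q1 [Pqq sz_q or_q]] := trim_mod_ideal q IP.
have Pq1 : P q1.
  by rewrite -[q1](subKr q); apply: idealB => //; apply: ideal_coefs.
have q1_0 : q1 = 0.
  case: or_q => // nPlq; exfalso; apply: (nPlq); apply: fmin => //.
  rewrite ltnNge; apply/negP => le_fq.
  have lqh : lead_coef q1 * lead_coef h != 0.
    apply/eqP => l0; have : P (lead_coef q1 * lead_coef h)%:P by rewrite l0.
    by rewrite polyCM => /PM[].
  have := size_proper_mul lqh; set N := size (q1 * h) => sz_N.
  have : P ((q1 * h)`_N.-1)%:P.
    have -> : q1 * h = lead_coef h ^+ k *: f - r - h * (q - q1) by rewrite E; ring.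
    have aux (a b c d M : nat) : (d < b -> a <= c -> M = (c + b).-1 ->
        1 < b -> 1 < a -> a <= M.-1 /\ d <= M.-1)%N by lia.
    have [le_fN le_rN] := aux _ _ _ _ _ lt_r le_fq sz_N sz1_h sz1_f.
    rewrite coefB coefB coefZ [f`__]nth_default // [r`__]nth_default //.
    by rewrite mulr0 subr0 sub0r polyCN; apply: (idealN IP); apply: Pcfs.
  rewrite -lead_coefE lead_coef_proper_mul // polyCM.
  by case/PM.
have := Pcfs h _ Pqq; rewrite q1_0 subr0 mulrC => Pqh.
case: (@PM (lead_coef h ^+ k)%:P (lead_coef f)%:P) => //.
rewrite -polyCM -coefZ E coefD polyCD; exact: PD.
Qed.

Definition eval_at (A B : comNzRingType) (phi : {rmorphism A -> B}) (x : B) :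
  {rmorphism {poly A} -> B} := horner_morph (fun a => mulrC x (phi a)).

Lemma eval_atE (A B : comNzRingType) (phi : {rmorphism A -> B}) x p :
  eval_at phi x p = (map_poly phi p).[x].
Proof. by []. Qed.

Lemma eval_atC (A B : comNzRingType) (phi : {rmorphism A -> B}) x a :
  eval_at phi x a%:P = phi a.
Proof. exact: horner_morphC. Qed.

Lemma eval_atX (A B : comNzRingType) (phi : {rmorphism A -> B}) x :
  eval_at phi x 'X = x.
Proof. exact: horner_morphX. Qed.

(** A [K]-point of [A] killing the contraction of [P] is extended to the variable: by a root of [f]
    if some [f] in [P] is nonzero modulo the contraction, otherwise by any value that is not a root
    of [g]. *)
Lemma separates_points_poly (K : closedFieldType) (A : comNzRingType) (c : K -> A) :
  separates_points c -> separates_points (fun x => (c x)%:P).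
Proof.
move=> sepA P g PP nPg; have [IP nP1 PM] := PP; have [P0 PD PZ] := IP.
have PPA : prime_ideal (fun a => P a%:P).
  split=> // [|a b]; last by rewrite polyCM; apply: PM.
  split=> // [a b|a b]; first by rewrite polyCD; apply: PD.
  by rewrite polyCM; apply: PZ.
have kill (phi : {rmorphism A -> K}) x (h : {poly A}) : (forall a, P a%:P -> phi a = 0) ->
    (forall i, P (h`_i)%:P) -> eval_at phi x h = 0.
  move=> phiP Ph; rewrite eval_atE.
  suff -> : map_poly phi h = 0 by rewrite horner0.
  by apply/polyP => i; rewrite coef_map /= phiP // coef0.
have [[f Pf nf]|allP] := classic (exists2 f, P f & ~ forall i, P (f`_i)%:P).
  have [{Pf nf}f [d [Pf nPd [sz_f nPl] [a [b [w [dE Pw]]]] fdiv]]] :=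
    prime_poly_bezout PP nPg (ex_intro2 _ _ f Pf nf).
  (* Where [lead_coef f] is nonzero, the specialized [f] keeps its positive degree and has a root;
     where [d] is nonzero, the Bezout relation prevents [g] from vanishing at that root. *)
  have [] := sepA _ (lead_coef f * d) PPA.
    by rewrite polyCM => /PM[].
  move=> phi [phic phiP]; rewrite rmorphM mulf_eq0 negb_or => /andP[phil phid].
  have /closed_rootP[x] : size (map_poly phi f) != 1%N.
    by rewrite size_map_poly_id0 //; case: (size f) sz_f => [|[]].
  move=> /rootP fx; exists (eval_at phi x); split=> [y|p Pp|].
  - by rewrite eval_atC.
  - have [k [q [r [E Pr]]]] := fdiv p Pp.
    have := congr1 (eval_at phi x) E; rewrite rmorphD rmorphM /= (kill _ _ r) //.
    rewrite [eval_at phi x f]eval_atE fx mulr0 addr0 -mul_polyC rmorphM /=.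
    rewrite eval_atC rmorphXn => /eqP; rewrite mulf_eq0 expf_eq0 (negPf phil) andbF.
    by move/eqP.
  - apply/eqP => g0; case/eqP: phid; rewrite -(eval_atC phi x) dE.
    by rewrite !rmorphD !rmorphM /= g0 [eval_at phi x f]eval_atE fx !mulr0 (kill _ _ w) ?addr0.
have [i nPi] : exists i, ~ P (g`_i)%:P.
  apply: not_all_ex_not => Pgi; apply: nPg; exact: ideal_coefs.
have [phi [phic phiP phig]] := sepA _ _ PPA nPi.
have /closed_nonrootP[x gx] : map_poly phi g != 0.
  by apply/eqP => /polyP/(_ i); rewrite coef_map coef0; apply/eqP.
exists (eval_at phi x); split=> // [y|p Pp]; first by rewrite eval_atC.
apply: kill => // j; apply: NNPP => nPj; apply: allP; exists p => // Pp'; exact: nPj.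
Qed.

Fixpoint constn (R : comNzRingType) (m : nat) : {rmorphism R -> polyn R m} :=
  match m with
  | 0 => idfun
  | m'.+1 => (polyC \o constn R m' : {rmorphism R -> {poly polyn R m'}})
  end.

Lemma separates_points_polyn (K : closedFieldType) (A : comNzRingType) (c : K -> A) m :
  separates_points c -> separates_points (fun x => constn A m (c x)).
Proof. by move=> sepA; elim: m => //= m; apply: separates_points_poly. Qed.

(** * Bundled morphisms and specialization at a point *)

Fixpoint liftn_morph (R S : comNzRingType) (f : {rmorphism R -> S}) (m : nat) :
    {rmorphism polyn R m -> polyn S m} :=
  match m with
  | 0 => f
  | m'.+1 => (map_poly (liftn_morph f m') : {rmorphism {poly polyn R m'} -> {poly polyn S m'}})
  end.

Lemma liftnE (R S : comNzRingType) (f : R -> S) (g : {rmorphism R -> S}) m :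
  f =1 g -> liftn f m =1 liftn_morph g m.
Proof. by move=> fg; elim: m => //= m IH p; apply: eq_map_poly. Qed.

Fixpoint evalF_morph (K S : comNzRingType) (iota : {rmorphism K -> S}) (F : nat -> S) n :
    {rmorphism polyn K n -> S} :=
  match n with
  | 0 => iota
  | n'.+1 => eval_at (evalF_morph iota F n') (F n')
  end.

Lemma evalFE (K S : comNzRingType) (iota : {rmorphism K -> S}) (F : nat -> S) n :
  evalF iota F n =1 evalF_morph iota F n.
Proof. by elim: n => //= n IH p; rewrite eval_atE; congr _.[_]; apply: eq_map_poly. Qed.

Lemma evalF_morphC (K S : comNzRingType) (iota : {rmorphism K -> S}) (F : nat -> S) n c :
  evalF_morph iota F n (constn K n c) = iota c.
Proof. by elim: n => //= n IH; rewrite eval_atC. Qed.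

Lemma evalF_morphX (K S : comNzRingType) (iota : {rmorphism K -> S}) (F : nat -> S) n i :
  (i < n)%N -> exists x, evalF_morph iota F n x = F i.
Proof.
elim: n => // n IH; rewrite ltnS leq_eqVlt => /orP[/eqP->|/IH[x xE]].
  by exists 'X => /=; rewrite eval_atX.
by exists x%:P => /=; rewrite eval_atC.
Qed.

Lemma congr_morph_poly (A B : comNzRingType) (J : B -> Prop)
    (g h : {rmorphism {poly A} -> B}) :
  is_ideal J -> (forall a, J (g a%:P - h a%:P)) -> J (g 'X - h 'X) ->
  forall p, J (g p - h p).
Proof.
move=> IJ JC JX; have [J0 JD JM] := IJ; elim/poly_ind => [|p c IH].
  by rewrite !rmorph0 subrr.
rewrite !rmorphD !rmorphM /=.
have -> : g p * g 'X + g c%:P - (h p * h 'X + h c%:P) =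
  g p * (g 'X - h 'X) + h 'X * (g p - h p) + (g c%:P - h c%:P) by ring.
by apply: (JD) => //; apply: JD; apply: JM.
Qed.

(** The [a i] are the coordinates of the point [phi]. *)
Lemma evalF_morph_point (K S : comNzRingType) (iota : {rmorphism K -> S}) (F : nat -> S)
    n (phi : {rmorphism polyn K n -> K}) :
  (forall c, phi (constn K n c) = c) ->
  exists a : nat -> K, forall x,
    ideal_gen (fun i => F i - iota (a i)) n (evalF_morph iota F n x - iota (phi x)).
Proof.
elim: n phi => [|n IH] phi phic.
  exists (fun=> 0) => x /=; rewrite -[phi x]/(phi (constn K 0 x)) phic subrr.
  by case: (ideal_gen_ideal (fun i => F i - iota 0) 0).
have [a aP] := IH (phi \o polyC : {rmorphism _ -> _}) phic.
exists (fun i => if (i < n)%N then a i else phi 'X).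
have IJ k := ideal_gen_ideal (fun i => F i - iota (if (i < n)%N then a i else phi 'X)) k.
apply: (@congr_morph_poly _ _ _ (evalF_morph iota F n.+1) (iota \o phi)) => //= [x|].
  rewrite eval_atC; apply: ideal_gen_le.
  have [b ->] := aP x; exists b; apply: eq_bigr => i _; by rewrite ltn_ord.
rewrite eval_atX.
have := ideal_gen_mem (fun i => F i - iota (if (i < n)%N then a i else phi 'X)) (ltnSn n).
by rewrite ltnn.
Qed.

(** [psi] fixes [S] and evaluates each added variable at the scalar that [phi] gives it; followed by
    reduction modulo [J], it is the passage to the fibre over [phi]. *)
Lemma liftn_morph_point (K R S : comNzRingType) (iota : {rmorphism K -> S})
    (f : {rmorphism R -> S}) (J : S -> Prop) m (phi : {rmorphism polyn R m -> K}) :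
  is_ideal J -> (forall x, J (f x - iota (phi (constn R m x)))) ->
  exists psi : {rmorphism polyn S m -> S},
    (forall s, psi (constn S m s) = s) /\
    forall x, J (psi (liftn_morph f m x) - iota (phi x)).
Proof.
move=> IJ; elim: m phi => [|m IH] phi Jphi; first by exists idfun.
have [psi [psiC psiJ]] := IH (phi \o polyC : {rmorphism _ -> _}) Jphi.
exists (eval_at psi (iota (phi 'X))); split=> [s|] /=; first by rewrite eval_atC.
apply: (@congr_morph_poly _ _ _ (eval_at psi (iota (phi 'X)) \o map_poly (liftn_morph f m))
  (iota \o phi)) => //= [x|].
  by rewrite map_polyC /= eval_atC.
by rewrite map_polyX eval_atX subrr; case: IJ.
Qed.

Lemma bounded_choice (T : Type) (R : nat -> T -> Prop) n (x0 : T) :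
  (forall i, (i < n)%N -> exists x, R i x) ->
  exists f : nat -> T, forall i, (i < n)%N -> R i (f i).
Proof.
move=> ex_R; exists (fun i => epsilon (inhabits x0) (R i)) => i /ex_R.
exact: epsilon_spec.
Qed.

(** * Homogenization in a graded domain *)

Section Graded.
Variables (K : fieldType) (S : idomainType) (iota : {rmorphism K -> S}).
Variable Sd : nat -> S -> Prop.
Hypothesis grading : is_Ngrading iota Sd.

(* An element of S is encoded by its homogenization, the polynomial in S[t] whose
   coefficient at t^d is the component of degree d; t = 1 gives the element back. *)
Definition homog (p : {poly S}) := forall i, Sd i p`_i.

Lemma homogD p q : homog p -> homog q -> homog (p + q).
Proof. by case: grading => _ SD _ _ _ hp hq i; rewrite coefD; apply: SD. Qed.

Lemma homogZ c p : homog p -> homog (iota c *: p).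
Proof. by case: grading => _ _ SZ _ _ hp i; rewrite coefZ; apply: SZ. Qed.

Lemma homogB p q : homog p -> homog q -> homog (p - q).
Proof.
move=> hp /(homogZ (-1)); rewrite rmorphN1 scaleN1r; exact: homogD.
Qed.

Lemma homog0 : homog 0.
Proof. by case: grading => S0 _ _ _ _ i; rewrite coef0. Qed.

Lemma homog_sum k (p : nat -> {poly S}) :
  (forall i, (i < k)%N -> homog (p i)) -> homog (\sum_(i < k) p i).
Proof.
move=> hp; elim/big_ind: _ => [|p' q|i _]; [exact: homog0|exact: homogD|exact: hp].
Qed.

Lemma homogM p q : homog p -> homog q -> homog (p * q).
Proof.
case: grading => S0 SD _ SM _ hp hq i; rewrite coefM.
elim/big_ind: _ => [//|x y|j _]; first exact: SD.
by have := SM _ _ _ _ (hp j) (hq (i - j)%N); rewrite subnKC // -ltnS.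
Qed.

Lemma homog_monomial d x : Sd d x -> homog (x *: 'X^d).
Proof.
case: grading => S0 _ _ _ _ Sx i; rewrite coefZ coefXn.
by case: eqP => [->|_]; rewrite ?mulr1 ?mulr0.
Qed.

Lemma homog_exists s : exists p, homog p /\ p.[1] = s.
Proof.
case: grading => S0 _ _ _ [/(_ s)[N [c [Sc ->]]] _].
exists (\poly_(i < N) c i); split=> [i|].
  by rewrite coef_poly; case: ifP.
rewrite (@horner_coef_wide _ N) ?size_poly //; apply: eq_bigr => i _.
by rewrite coef_poly ltn_ord expr1n mulr1.
Qed.

Lemma homog_inj p q : homog p -> homog q -> p.[1] = q.[1] -> p = q.
Proof.
move=> hp hq pq; apply/eqP; rewrite -subr_eq0; apply/eqP/polyP => i.
have := homogB hp hq; set r := p - q => hr; rewrite coef0.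
case: grading => _ _ _ _ [_ uniq_comp].
have [lt_i|le_i] := ltnP i (size r); last by rewrite nth_default.
apply: (uniq_comp (size r) (fun i => r`_i)) => //.
transitivity r.[1]; last by rewrite hornerD hornerN pq subrr.
by rewrite horner_coef; apply: eq_bigr => j _; rewrite expr1n mulr1.
Qed.

(** * Leading forms modulo [F i] and modulo [F i - iota (a i)] *)

Variables (n : nat) (F : nat -> S) (dF : nat -> nat).
Hypothesis homogF : forall i, (i < n)%N -> (0 < dF i)%N /\ Sd (dF i) (F i).

(** Homogenizing the cofactors of [F i] gives a combination of the [F i *: 'X^(dF i)], which equals
    [p] because homogenizations are unique; the coefficient at [d] is then read off. *)
Lemma homog_coef_gen k p d : (k <= n)%N -> homog p -> ideal_gen F k p.[1] ->
  exists h : nat -> S, p`_d = \sum_(i < k) h i * F i /\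
    forall i, (i < k)%N -> h i = 0 \/ (dF i <= d)%N /\ Sd (d - dF i) (h i).
Proof.
move=> le_kn hp [a pE].
have [q hq] := @bounded_choice _ (fun i q => homog q /\ q.[1] = a i) k 0
  (fun i _ => homog_exists (a i)).
have -> : p = \sum_(i < k) q i * (F i *: 'X^(dF i)).
  apply: homog_inj => //.
    apply: (@homog_sum _ (fun i => q i * (F i *: 'X^(dF i)))) => i lt_ik.
    apply: homogM; first by have [] := hq i lt_ik.
    by apply: homog_monomial; have [] := homogF (leq_trans lt_ik le_kn).
  rewrite pE horner_sum; apply: eq_bigr => i _.
  by rewrite hornerM hornerZ hornerXn expr1n mulr1; have [_ ->] := hq i (ltn_ord i).
exists (fun i => if (d < dF i)%N then 0 else (q i)`_(d - dF i)); split=> [|i lt_ik].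
  rewrite coef_sum; apply: eq_bigr => i _.
  rewrite -scalerAr coefZ coefMXn; case: ifP => _; first by rewrite mulr0 mul0r.
  exact: mulrC.
case: ltnP => [_|le_d]; first by left.
by right; split=> //; have [hqi _] := hq i lt_ik.
Qed.

Variable a : nat -> K.
Let G i := F i - iota (a i).

(** Replacing a leading form [h i * F i], summed over [i], by the sum of [iota (a i) * h i]
    subtracts a member of the ideal of [G], and lowers the degree because each [F i] has positive
    degree. *)
Lemma homog_reduce k p : (k <= n)%N -> homog p -> p != 0 ->
  ideal_gen F k (lead_coef p) ->
  exists p', [/\ homog p', (size p' < size p)%N & ideal_gen G k (p.[1] - p'.[1])].
Proof.
move=> le_kn hp p0 Qp; set d := (size p).-1.
have hl : homog (lead_coef p *: 'X^d) by apply: homog_monomial; apply: hp.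
have [|h []] := @homog_coef_gen k _ d le_kn hl.
  by rewrite hornerZ hornerXn expr1n mulr1.
rewrite coefZ coefXn eqxx mulr1 => lE hh.
pose r i := iota (a i) *: (h i *: 'X^(d - dF i)).
exists (p - lead_coef p *: 'X^d + \sum_(i < k) r i); split.
- apply: homogD; first exact: homogB.
  apply: homog_sum => i lt_ik; apply: homogZ.
  case: (hh i lt_ik) => [->|[_ Sh]]; last exact: homog_monomial.
  by rewrite scale0r; apply: homog0.
- have sz_p : (0 < size p)%N by rewrite size_poly_gt0.
  rewrite -(prednK sz_p) ltnS -/d; apply/leq_sizeP => j le_dj.
  rewrite coefD coefB coefZ coefXn coef_sum big1 ?addr0 => [|i _].
    have [->|ne_j] := eqVneq j d; first by rewrite mulr1 subrr.
    by rewrite mulr0 subr0 nth_default // -(prednK sz_p) ltn_neqAle eq_sym ne_j.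
  rewrite !coefZ coefXn; case: (hh i (ltn_ord i)) => [->|[le_d _]].
    by rewrite mul0r mulr0.
  have [] := homogF (leq_trans (ltn_ord i) le_kn) => dF0 _.
  by rewrite (_ : (j == _) = false) ?mulr0 //; apply/eqP; lia.
- exists h; rewrite hornerD hornerD hornerN hornerZ hornerXn expr1n mulr1 lE.
  rewrite horner_sum opprD opprB addrCA addrA subrK -sumrB.
  apply: eq_bigr => i _; rewrite /r !hornerZ hornerXn expr1n /G; ring.
Qed.

Lemma homog_normal_form k s : (k <= n)%N ->
  exists p, [/\ homog p, ideal_gen G k (s - p.[1]) &
                p = 0 \/ ~ ideal_gen F k (lead_coef p)].
Proof.
move=> le_kn; have [p [hp <-]] := homog_exists s.
have IG := ideal_gen_ideal G k; have [I0 ID _] := IG.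
elim: {p}(size p) {-2}p (leqnn (size p)) hp => [|N IH] p le_pN hp.
  exists p; split=> //; first by rewrite subrr.
  by left; apply/eqP; rewrite -size_poly_leq0.
have [Qp|] := classic (ideal_gen F k (lead_coef p)); last first.
  by exists p; split=> //; [rewrite subrr | right].
have [->|p0] := eqVneq p 0.
  by exists 0; split=> //; [exact: homog0 | rewrite subrr | left].
have [p' [hp' lt_p' Gp']] := homog_reduce le_kn hp p0 Qp.
have [|q [hq Gq or_q]] := IH p' _ hp'; first by rewrite -ltnS (leq_trans lt_p').
exists q; split=> //; rewrite -(subrK p'.[1] p.[1]) -addrA; exact: ID.
Qed.

Hypothesis regF : forall i, (i < n)%N ->
  forall s, ideal_gen F i (F i * s) -> ideal_gen F i s.

(** Induction on [k]. In [j + g * G k], with [j] in the ideal of the earlier [G i], [g] may be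
    replaced by its normal form [r]. Regularity keeps [F k * lead_coef r] outside [ideal_gen F k],
    while the leading form of the remainder lies inside by induction, so the two cannot cancel. *)
Lemma lead_coef_point k p : (k <= n)%N -> homog p ->
  ideal_gen G k p.[1] -> ideal_gen F k (lead_coef p).
Proof.
elim: k p => [|k IH] p lt_kn hp.
  move=> [b]; rewrite big_ord0 => p1.
  rewrite (homog_inj hp homog0) ?horner0 // lead_coef0.
  by case: (ideal_gen_ideal F 0).
have le_kn := ltnW lt_kn.
have [IG0 IGD IGM] := ideal_gen_ideal G k.
have IF := ideal_gen_ideal F k; have [IF0 IFD IFM] := IF.
have [IS0 ISD ISM] := ideal_gen_ideal F k.+1.
case/ideal_genS => j [g [Gj pE]].
have [r [hr Gr or_r]] := homog_normal_form g le_kn.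
have {Gj Gr}Gpr : ideal_gen G k (p.[1] - r.[1] * G k).
  rewrite pE (_ : _ - _ = j + G k * (g - r.[1])); last by ring.
  by apply: IGD => //; apply: IGM.
have [dk0 SdF] := homogF lt_kn.
case: or_r => [r0|nQr].
  by apply/ideal_gen_le/IH => //; move: Gpr; rewrite r0 horner0 mul0r subr0.
(* [z1 - z2] is the homogenization of [r.[1] * G k]; as [dF k] is positive, [z1] alone provides its
   leading form. *)
pose z1 := r * (F k *: 'X^(dF k)); pose z2 := iota (a k) *: r.
have hz : homog (z1 - z2).
  apply: homogB; last exact: homogZ.
  by apply: homogM => //; apply: homog_monomial.
have nQFr : ~ ideal_gen F k (F k * lead_coef r) by move/(regF lt_kn).
have Fk0 : F k != 0 by apply/eqP => Fk0; apply: nQFr; rewrite Fk0 mul0r.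
have r0 : r != 0 by apply/eqP => r0; apply: nQr; rewrite r0 lead_coef0.
have lead_z : lead_coef (z1 - z2) = F k * lead_coef r.
  rewrite lead_coefDl /z1 -scalerAr ?lead_coefZ ?lead_coefM ?lead_coefXn ?mulr1 //.
  rewrite size_polyN [X in (_ < X)%N]size_scale // size_mulXn //.
  apply: leq_ltn_trans (size_scale_leq _ _) _.
  by rewrite -[X in (X < _)%N]add0n ltn_add2r.
set z := z1 - z2 in hz lead_z.
have hw := homogB hp hz; set w := p - z in hw.
have Qw : ideal_gen F k (lead_coef w).
  apply: IH => //; rewrite /w /z /z1 /z2 hornerD hornerN hornerD hornerN hornerM.
  rewrite !hornerZ hornerXn expr1n mulr1.
  by rewrite [_ - _ * _](_ : _ = r.[1] * G k) // /G; ring.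
have Qz : ideal_gen F k.+1 (lead_coef z).
  by rewrite lead_z mulrC; apply/ISM/ideal_gen_mem.
have -> : p = w + z by rewrite subrK.
have [lt_wz|lt_zw|eq_wz] := ltngtP (size w) (size z).
- by rewrite lead_coefDr.
- by rewrite lead_coefDl //; apply: ideal_gen_le.
have lead_wz : lead_coef w + lead_coef z != 0.
  apply/eqP => wz0; apply: nQFr; rewrite -lead_z.
  by rewrite -[lead_coef z](addKr (lead_coef w)) wz0 addr0; apply: idealN.
have lead_E : (w + z)`_(size z).-1 = lead_coef w + lead_coef z.
  by rewrite coefD !lead_coefE eq_wz.
suff sz_wz : size (w + z) = size z.
  by rewrite lead_coefE sz_wz lead_E; apply: ISD => //; apply: ideal_gen_le.
apply/eqP; rewrite eqn_leq; apply/andP; split.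
  by apply: leq_trans (size_polyD _ _) _; rewrite eq_wz maxnn.
rewrite leqNgt; apply/negP => lt_sz; case/eqP: lead_wz; rewrite -lead_E.
by rewrite nth_default // -ltnS (leq_trans lt_sz) // leqSpred.
Qed.

Hypothesis primeQ : prime_ideal (ideal_gen F n).

(** If both normal forms are nonzero, their leading forms lie outside the prime [Q], hence so does
    the leading form of their product, which therefore is not in the ideal of [G]. *)
Lemma ideal_gen_point_prime u v :
  ideal_gen G n (u * v) -> ideal_gen G n u \/ ideal_gen G n v.
Proof.
move=> Guv; have [IG0 IGD IGM] := ideal_gen_ideal G n.
have [p [hp Gp or_p]] := homog_normal_form u (leqnn n).
have [q [hq Gq or_q]] := homog_normal_form v (leqnn n).
case: or_p => [p0|nQp]; first by left; move: Gp; rewrite p0 horner0 subr0.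
case: or_q => [q0|nQq]; first by right; move: Gq; rewrite q0 horner0 subr0.
have Gpq : ideal_gen G n (p * q).[1].
  have -> : (p * q).[1] = u * v + (- v) * (u - p.[1]) + (- p.[1]) * (v - q.[1]).
    by rewrite hornerM; ring.
  by apply: (IGD); [apply: IGD => //|]; apply: IGM.
have := lead_coef_point (leqnn n) (homogM hp hq) Gpq.
by rewrite lead_coefM; case: primeQ => _ _ PM /PM[].
Qed.

(** * Homogeneous families independent modulo [Q], and their spans *)

Definition indep_mod_F k (E : nat -> S) :=
  (forall i, (i < k)%N -> exists d, Sd d (E i)) /\
  forall c : nat -> K, ideal_gen F n (\sum_(i < k) iota (c i) * E i) ->
    forall i, (i < k)%N -> c i = 0.

(** The leading form of the homogenized relation lies in [Q] and involves only members of one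
    degree, so independence makes it zero. Hence the whole homogenization is zero, and each degree
    gives a relation modulo [Q]. *)
Lemma indep_mod_point k E (c : nat -> K) : indep_mod_F k E ->
  ideal_gen G n (\sum_(i < k) iota (c i) * E i) -> forall i, (i < k)%N -> c i = 0.
Proof.
move=> [/(bounded_choice 0%N)[e Ee] indE] Gc.
have [IF0 _ _] := ideal_gen_ideal F n.
pose p := \sum_(i < k) iota (c i) *: (E i *: 'X^(e i)).
have hp : homog p.
  apply: (@homog_sum _ (fun i => iota (c i) *: (E i *: 'X^(e i)))) => i lt_ik.
  by apply/homogZ/homog_monomial/Ee.
have p1 : p.[1] = \sum_(i < k) iota (c i) * E i.
  rewrite horner_sum; apply: eq_bigr => i _.
  by rewrite !hornerZ hornerXn expr1n mulr1.
have c0 d : ideal_gen F n p`_d -> forall i, (i < k)%N -> e i = d -> c i = 0.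
  move=> Qpd i lt_ik ei.
  have := indE (fun j => if e j == d then c j else 0) _ i lt_ik; rewrite ei eqxx.
  apply; have <- // : p`_d = \sum_(j < k) iota (if e j == d then c j else 0) * E j.
  rewrite coef_sum; apply: eq_bigr => j _.
  rewrite !coefZ coefXn eq_sym; case: ifP => _; first by rewrite mulr1.
  by rewrite (rmorph0 iota) mul0r !mulr0.
have p0 : p = 0.
  apply/eqP; rewrite -lead_coef_eq0; apply/eqP.
  have Ql : ideal_gen F n (lead_coef p).
    by apply: lead_coef_point => //; rewrite p1.
  rewrite lead_coefE coef_sum big1 // => i _; rewrite !coefZ coefXn.
  have [ei|] := eqVneq (size p).-1 (e i); last by rewrite !mulr0.
  by rewrite (c0 _ Ql i) // rmorph0 mul0r.
by move=> i lt_ik; apply: (c0 (e i)) => //; rewrite p0 coef0.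
Qed.

Definition spanned (A B : comNzRingType) (f : A -> B) (inj : S -> B) k (E : nat -> S) u :=
  exists alpha : nat -> A, u = \sum_(i < k) f (alpha i) * inj (E i).

(** Finite families stand in for a possibly infinite basis modulo [Q]. Starting from an arbitrary
    family allows several elements to be treated in turn, each enlarging the family left by the
    previous one. *)
Definition spannable (A B : comNzRingType) (f : A -> B) (inj : S -> B) u :=
  forall k E, indep_mod_F k E ->
  exists k' E', [/\ indep_mod_F k' E', (k <= k')%N,
    forall i, (i < k)%N -> E' i = E i & spanned f inj k' E' u].

Section Spannable.
Variables (A B : comNzRingType) (f : {rmorphism A -> B}) (inj : S -> B).

Lemma spanned_extend k E k' E' u : (k <= k')%N -> (forall i, (i < k)%N -> E' i = E i) ->
  spanned f inj k E u -> spanned f inj k' E' u.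
Proof.
move=> le_kk' EE' [al ->]; exists (fun i => if (i < k)%N then al i else 0).
rewrite [RHS](eq_bigr (fun i : 'I_k' => if (i < k)%N then f (al i) * inj (E' i) else 0)).
  rewrite -big_mkcond /= (big_ord_widen k' (fun i => f (al i) * inj (E i)) le_kk').
  by apply: eq_bigr => i lt_i; rewrite EE'.
by move=> i _; case: ifP => // _; rewrite rmorph0 mul0r.
Qed.

Lemma spannedD k E u v :
  spanned f inj k E u -> spanned f inj k E v -> spanned f inj k E (u + v).
Proof.
move=> [al ->] [be ->]; exists (fun i => al i + be i).
by rewrite -big_split; apply: eq_bigr => i _; rewrite rmorphD mulrDl.
Qed.

Lemma spannable0 : spannable f inj 0.
Proof.
move=> k E indE; exists k, E; split=> //; exists (fun=> 0).
by rewrite big1 // => i _; rewrite rmorph0 mul0r.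
Qed.

Lemma spannableD u v : spannable f inj u -> spannable f inj v -> spannable f inj (u + v).
Proof.
move=> spu spv k E /spu[k1 [E1 [/spv[k2 [E2 [ind2 le12 E12 sp2]]] le01 E01 sp1]]].
exists k2, E2; split=> //; first exact: leq_trans le12.
  by move=> i lt_i; rewrite E12 ?E01 // (leq_trans lt_i).
by apply: spannedD => //; apply: spanned_extend sp1.
Qed.

Lemma spannableM x u : spannable f inj u -> spannable f inj (f x * u).
Proof.
move=> spu k E /spu[k1 [E1 [ind1 le1 E01 [al ->]]]].
exists k1, E1; split=> //; exists (fun i => x * al i).
by rewrite mulr_sumr; apply: eq_bigr => i _; rewrite rmorphM mulrA.
Qed.

Lemma spannable_sum k (u : nat -> B) : (forall i, (i < k)%N -> spannable f inj (u i)) ->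
  spannable f inj (\sum_(i < k) u i).
Proof.
move=> spu; elim/big_ind: _ => [|x y|i _]; [exact: spannable0|exact: spannableD|exact: spu].
Qed.
End Spannable.

(** A nonzero scalar at [s] in a relation could be inverted, expressing [s] through [E] modulo
    [Q]. *)
Lemma indep_mod_F_extend k E s d : indep_mod_F k E -> Sd d s ->
  ~ (exists c : nat -> K, ideal_gen F n (s - \sum_(i < k) iota (c i) * E i)) ->
  indep_mod_F k.+1 (fun i => if i == k then s else E i).
Proof.
move=> [hE indE] Ss nc; have [_ _ IFM] := ideal_gen_ideal F n.
have Elt i : (i < k)%N -> (if i == k then s else E i) = E i by case: eqP => // ->; rewrite ltnn.
split=> [i|c].
  rewrite ltnS leq_eqVlt; case: eqP => [_ _|_]; [by exists d | exact: hE].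
rewrite big_ord_recr /= eqxx (eq_bigr (fun i : 'I_k => iota (c i) * E i)); last first.
  by move=> i _; rewrite Elt.
move=> Qc.
have [ck0|ck0] := eqVneq (c k) 0.
  move: Qc; rewrite ck0 rmorph0 mul0r addr0 => /indE c0 i.
  by rewrite ltnS leq_eqVlt => /orP[/eqP->|/c0].
case: nc; exists (fun i => - (c i / c k)).
have -> : s - \sum_(i < k) iota (- (c i / c k)) * E i =
    iota (c k)^-1 * (\sum_(i < k) iota (c i) * E i + iota (c k) * s).
  rewrite mulrDr mulrA -rmorphM mulVf // rmorph1 mul1r addrC mulr_sumr -sumrN.
  congr (_ + _); apply: eq_bigr => i _.
  by rewrite rmorphN mulNr opprK mulrA -rmorphM mulrC [_^-1 * _]mulrC mulrC.
exact: IFM.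
Qed.

Section SpannableBase.
Variables (A : comNzRingType) (f : {rmorphism A -> S}).
Hypothesis f_scalar : forall c, exists x, f x = iota c.
Hypothesis f_F : forall i, (i < n)%N -> exists x, f x = F i.

(* Graded Nakayama: a homogeneous s that depends on E modulo Q is a combination of E
   up to multiples of the F_i by elements of smaller degree. *)
Lemma spannable_homog d s : Sd d s -> spannable f id s.
Proof.
elim/ltn_ind: d s => d IH s Ss k E indE.
have [[c Qc]|nc] := classic (exists c : nat -> K,
    ideal_gen F n (s - \sum_(i < k) iota (c i) * E i)); last first.
  exists k.+1, (fun i => if i == k then s else E i); split=> //.
  - exact: indep_mod_F_extend indE Ss nc.
  - by move=> i lt_ik; rewrite (ltn_eqF lt_ik).
  exists (fun i => if i == k then 1 else 0).
  rewrite big_ord_recr /= eqxx rmorph1 mul1r big1 ?add0r // => i _.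
  by rewrite (ltn_eqF (ltn_ord i)) rmorph0 mul0r.
have [/(bounded_choice 0%N)[e Ee] _] := indE.
pose p := s *: 'X^d - \sum_(i < k) iota (c i) *: (E i *: 'X^(e i)).
have hp : homog p.
  apply: homogB; first exact: homog_monomial.
  apply: (@homog_sum _ (fun i => iota (c i) *: (E i *: 'X^(e i)))) => i lt_ik.
  by apply/homogZ/homog_monomial/Ee.
have p1 : p.[1] = s - \sum_(i < k) iota (c i) * E i.
  rewrite hornerD hornerN hornerZ hornerXn expr1n mulr1 horner_sum; congr (_ - _).
  by apply: eq_bigr => i _; rewrite !hornerZ hornerXn expr1n mulr1.
(* In degree [d] the members of [E] of other degrees drop out, and each [h i] is zero or of degree
   [d - dF i], smaller than [d], so that the induction hypothesis applies. *)
have [|h [pd hh]] := homog_coef_gen d (leqnn n) hp; first by rewrite p1.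
have sE : s = \sum_(i < n) h i * F i + \sum_(i < k) iota (if e i == d then c i else 0) * E i.
  rewrite -pd coefB coefZ coefXn eqxx mulr1 coef_sum.
  rewrite [X in _ - X + _]
    (_ : _ = \sum_(i < k) iota (if e i == d then c i else 0) * E i) ?subrK //.
  apply: eq_bigr => i _; rewrite !coefZ coefXn eq_sym; case: ifP => _; first by rewrite mulr1.
  by rewrite (rmorph0 iota) mul0r !mulr0.
have : spannable f id (\sum_(i < n) h i * F i).
  apply: (@spannable_sum _ _ _ _ _ (fun i => h i * F i)) => i lt_in.
  have [x <-] := f_F lt_in; rewrite mulrC; apply: spannableM.
  have [dF0 _] := homogF lt_in.
  case: (hh i lt_in) => [->|[le_d Sh]]; first exact: spannable0.
  by apply: IH Sh; lia.
case/(_ k E indE) => k' [E' [ind' le' EE' sp']].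
exists k', E'; split=> //; rewrite sE; apply: spannedD => //.
apply: (spanned_extend le' EE').
have [al alE] := @bounded_choice _
  (fun i x => f x = iota (if e i == d then c i else 0)) k 0 (fun i _ => f_scalar _).
by exists al; apply: eq_bigr => i _; rewrite alE.
Qed.

Lemma spannable_all s : spannable f id s.
Proof.
have [p [hp <-]] := homog_exists s; rewrite horner_coef.
apply: (@spannable_sum _ _ _ _ _ (fun i => p`_i * 1 ^+ i)) => i _.
by rewrite expr1n mulr1; apply: spannable_homog (hp i).
Qed.

(** Coefficients are handled with one variable fewer; the outer variable of the target is the image
    of ['X], so multiplying by it preserves spannability. *)
Lemma spannable_polyn m u : spannable (liftn_morph f m) (constn S m) u.
Proof.
elim: m u => [|m IH] u; first exact: spannable_all.
have spC v : spannable (liftn_morph f m.+1) (constn S m.+1) v%:P.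
  move=> k E /(IH v)[k' [E' [ind' le' EE' [al ->]]]].
  exists k', E'; split=> //; exists (fun i => (al i)%:P); rewrite rmorph_sum.
  by apply: eq_bigr => i _; rewrite /= map_polyC -polyCM.
elim/poly_ind: u => [|p v IHp]; first exact: spannable0.
apply: spannableD; last exact: spC.
have := spannableM (f := liftn_morph f m.+1) 'X IHp.
by rewrite /= map_polyX mulrC.
Qed.
End SpannableBase.
End Graded.

(** * Extension of a prime of [K[X][Y]] to [S[Y]] *)

Theorem theorem5p12 (K : closedFieldType) (S : idomainType)
    (iota : {rmorphism K -> S}) (Sd : nat -> S -> Prop) (n : nat) (F : nat -> S) :
  is_Ngrading iota Sd ->
  (forall i, (i < n)%N -> exists d, (0 < d)%N /\ Sd d (F i)) ->
  regular_seq F n ->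
  prime_ideal (ideal_gen F n) ->
  stable_prime_ext_prop (evalF iota F n).
Proof.
move=> grading /(bounded_choice 0%N)[dF homogF] [regF _] primeQ m P PP.
have [IP nP1 PM] := PP; have [P0 PD PZ] := IP.
pose f := evalF_morph iota F n; pose g := liftn_morph f m.
have gE : liftn (evalF iota F n) m =1 g by apply: liftnE; apply: evalFE.
have [|n1] := classic (ext_ideal (liftn (evalF iota F n) m) P 1); [by right | left].
split=> //.
  split.
  - by exists 0%N, (fun=> 0), (fun=> 0); rewrite big_ord0.
  - move=> x y [k [b [al [Pal ->]]]] [k' [b' [al' [Pal' ->]]]].
    exists (k + k')%N, (fun i => if (i < k)%N then b i else b' (i - k)%N),
      (fun i => if (i < k)%N then al i else al' (i - k)%N); split=> [i lt_i|].
      case: ltnP => [/Pal//|le_i]; apply: Pal'; lia.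
    rewrite big_split_ord; congr (_ + _); apply: eq_bigr => i _ /=.
      by rewrite ltn_ord.
    by rewrite ltnNge leq_addr /= addKn.
  - move=> c x [k [b [al [Pal ->]]]]; exists k, (fun i => c * b i), al; split=> //.
    by rewrite mulr_sumr; apply: eq_bigr => i _; rewrite mulrA.
move=> u v [k [b [al [Pal uvE]]]].
have spn := @spannable_polyn _ _ _ _ grading n F dF homogF _ f
  (fun c => ex_intro _ (constn K n c) (evalF_morphC iota F n c))
  (@evalF_morphX _ _ iota F n) m.
have ind0 : indep_mod_F iota Sd n F 0 (fun=> 0) by split.
apply: NNPP => /not_or_and[nu nv].
(* Were all coefficients in [P], the expansion itself would place [w] in the extended ideal. *)
have coef_out w : ~ ext_ideal (liftn (evalF iota F n) m) P w ->
    exists k E (x : nat -> polyn (polyn K n) m), [/\ indep_mod_F iota Sd n F k E,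
      w = \sum_(i < k) g (x i) * constn S m (E i) & exists2 i, (i < k)%N & ~ P (x i)].
  move=> nw; have [k' [E [ind _ _ [x wE]]]] := spn w _ _ ind0.
  exists k', E, x; split=> //; apply: NNPP => nex; apply: nw.
  exists k', (fun i => constn S m (E i)), x; split=> [i lt_i|].
    by apply: NNPP => nPx; apply: nex; exists i.
  by rewrite wE; apply: eq_bigr => i _; rewrite gE mulrC.
have [k1 [E1 [x1 [ind1 uE [i1 lt1 nP_1]]]]] := coef_out u nu.
have [k2 [E2 [x2 [ind2 vE [i2 lt2 nP_2]]]]] := coef_out v nv.
(* A single point avoiding the product keeps both coefficients nonzero. *)
have nP12 : ~ P (x1 i1 * x2 i2) by case/PM.
have sep := separates_points_polyn (m := m)
  (separates_points_polyn (m := n) (@separates_points_field K)).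
have [phi [phic phiP]] := sep _ _ PP nP12.
rewrite rmorphM mulf_eq0 negb_or => /andP[phi1 phi2].
have [a aP] := evalF_morph_point iota F (phi := phi \o constn (polyn K n) m) phic.
set G := fun i => F i - iota (a i) in aP.
have IG := ideal_gen_ideal G n; have [G0 GD GM] := IG.
have [psi [psiC psiP]] := liftn_morph_point IG aP.
(* Modulo the ideal of [G], [psi w] is the sum of the [iota (phi (x i)) * E i], and the [E i] stay
   independent there. *)
have Gpsi k' (E : nat -> S) (x : nat -> polyn (polyn K n) m) w :
    w = \sum_(i < k') g (x i) * constn S m (E i) ->
    indep_mod_F iota Sd n F k' E -> ideal_gen G n (psi w) ->
    forall i, (i < k')%N -> phi (x i) = 0.
  move=> -> ind' Gw i lt_i.
  apply: (indep_mod_point grading homogF regF ind' (c := fun i => phi (x i)) (a := a)) => //.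
  rewrite -[X in ideal_gen _ _ X](subKr (psi (\sum_(i < k') g (x i) * constn S m (E i)))).
  apply: idealB => //; rewrite rmorph_sum -sumrB.
  apply: (@ideal_sum _ _ _
    (fun i => psi (g (x i) * constn S m (E i)) - iota (phi (x i)) * E i)) => // j _.
  by rewrite rmorphM psiC -mulrBl; apply: idealMr.
(* Since [phi] kills [P], [psi] maps the extended ideal into that of [G]. *)
have Guv : ideal_gen G n (psi u * psi v).
  rewrite -rmorphM uvE rmorph_sum.
  apply: (@ideal_sum _ _ _
    (fun i => psi (b i * liftn (evalF iota F n) m (al i)))) => // i lt_i.
  rewrite rmorphM; apply: GM; rewrite gE.
  by have := psiP (al i); rewrite phiP ?rmorph0 ?subr0 //; apply: Pal.
case: (ideal_gen_point_prime grading homogF regF primeQ Guv) => [Gu|Gv].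
  by case/eqP: phi1; apply: (Gpsi _ _ _ _ uE).
by case/eqP: phi2; apply: (Gpsi _ _ _ _ vE).
Qed.
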